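(* For a complex $n\times n$ matrix $A$ let $\operatorname{ig}A:=\{S\in\mathbb C^{n\times n}\text{ nonsingular}\mid S^TAS=A\}$. Stars below denote arbitrary complex numbers (independent of each other), and all other parameters range over $\mathbb C$ subject to the stated conditions. (i) The $2\times 2$ canonical matrices under congruence have the following isometry groups: - $\operatorname{ig}\begin{bmatrix}0&0\\0&0\end{bmatrix}=\mathrm{GL}_2(\mathbb C)$; - $\operatorname{ig}\begin{bmatrix}1&0\\0&0\end{bmatrix}=\left\{\begin{bmatrix}\pm1&0\\ *&c\end{bmatrix}\,\middle|\,c\ne0\right\}$; - $\operatorname{ig}\begin{bmatrix}1&0\\0&1\end{bmatrix}=\mathrm O_2(\mathbb C)$; - $\operatorname{ig}\begin{bmatrix}0&1\\-1&0\end{bmatrix}=\mathrm{SL}_2(\mathbb C)$; - $\operatorname{ig}\begin{bmatrix}0&1\\ \lambda&0\end{bmatrix}=\left\{\begin{bmatrix}c&0\\0&1/c\end{bmatrix}\,\middle|\,c\ne0\right\}$ for $\lambda\in\mathbb C$, $\lambda\ne\pm1$; - $\operatorname{ig}\begin{bmatrix}0&-1\\1&1\end{bmatrix}=\left\{\pm\begin{bmatrix}1&*\\0&1\end{bmatrix}\right\}$. (ii) The $3\times 3$ canonical matrices under congruence have the following isometry groups: - $\operatorname{ig}0_3=\mathrm{GL}_3(\mathbb C)$; - $\operatorname{ig}\operatorname{diag}(1,0,0)=\left\{\begin{bmatrix}\pm1&0\\ u&B\end{bmatrix}\,\middle|\,u\in\mathbb C^{2\times1},\ B\in\mathbb C^{2\times2},\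 \det B\ne0\right\}$; - $\operatorname{ig}\operatorname{diag}(1,1,0)=\left\{\begin{bmatrix}A&0\\ u&c\end{bmatrix}\,\middle|\,A\in\mathbb C^{2\times 2},\ A^TA=I_2,\ u\in\mathbb C^{1\times 2},\ c\ne0\right\}$; - $\operatorname{ig}I_3=\mathrm O_3(\mathbb C)$; - $\operatorname{ig}\begin{bmatrix}0&1&0\\-1&0&0\\0&0&0\end{bmatrix}=\left\{\begin{bmatrix}A&0\\ u&c\end{bmatrix}\,\middle|\,A\in\mathbb C^{2\times2},\ \det A=1,\ u\in\mathbb C^{1\times2},\ c\ne0\right\}$; - $\operatorname{ig}\begin{bmatrix}0&1&0\\-1&0&0\\0&0&1\end{bmatrix}=\left\{\begin{bmatrix}A&0\\0&\pm1\end{bmatrix}\,\middle|\,A\in\mathbb C^{2\times2},\ \det A=1\right\}$; - $\operatorname{ig}\begin{bmatrix}0&1&0\\ \lambda&0&0\\0&0&0\end{bmatrix}=\left\{\begin{bmatrix}c&0&0\\0&1/c&0\\ *&*&c'\end{bmatrix}\,\middle|\,c,c'\ne0\right\}$ for $\lambda\in\mathbb C$, $\lambda\ne\pm1$; - $\operatorname{ig}\begin{bmatrix}0&1&0\\ \lambda&0&0\\0&0&1\end{bmatrix}=\left\{\begin{bmatrix}c&0&0\\0&1/c&0\\0&0&\pm1\end{bmatrix}\,\middle|\,c\ne0\right\}$ for $\lambda\in\mathbb C$, $\lambda\ne\pm1$; - $\operatorname{ig}\begin{bmatrix}0&-1&0\\1&1&0\\0&0&0\end{bmatrix}=\left\{\begin{bmatrix}\delta&*&0\\0&\delta&0\\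 *&*&c\end{bmatrix}\,\middle|\,\delta=\pm1,\ c\ne0\right\}$; - $\operatorname{ig}\begin{bmatrix}0&-1&0\\1&1&0\\0&0&1\end{bmatrix}=\left\{\begin{bmatrix}\delta&*&0\\0&\delta&0\\0&0&\pm1\end{bmatrix}\,\middle|\,\delta=\pm1\right\}$; - $\operatorname{ig}\begin{bmatrix}0&1&0\\0&0&1\\0&0&0\end{bmatrix}=\left\{\begin{bmatrix}c&a&0\\0&1/c&0\\0&-a&c\end{bmatrix}\,\middle|\,c\ne0,\ a\in\mathbb C\right\}$; - $\operatorname{ig}\begin{bmatrix}0&0&1\\0&-1&-1\\1&1&0\end{bmatrix}=\left\{\pm\begin{bmatrix}1&a&a^2/2\\0&1&a\\0&0&1\end{bmatrix}\,\middle|\,a\in\mathbb C\right\}$.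
   Context: $\operatorname{ig}A$ is called the isometry group of $A$. Here $\mathrm O_n(\mathbb C)=\{S\in\mathbb C^{n\times n}\mid S^TS=I_n\}$ and $\mathrm{SL}_2(\mathbb C)=\{S\in\mathbb C^{2\times2}\mid\det S=1\}$. The matrices listed are the canonical representatives of all congruence classes ($A\sim S^TAS$, $S$ nonsingular) of complex $2\times2$ and $3\times3$ matrices. Signs $\pm$ occurring within a matrix as the entry $\pm1$ are chosen independently of the other parameters. *)

(* Defs.v *)
From mathcomp Require Import all_boot all_order all_algebra.
From mathcomp Require Import classical_sets.

Set Implicit Arguments.
Unset Strict Implicit.
Unset Printing Implicit Defensive.

Import GRing.Theory.
Local Open Scope ring_scope.
Local Open Scope classical_set_scope.

Section IsometryGroups.
Variable K : fieldType.

Definition ig n (A : 'M[K]_n) : set 'M[K]_n :=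
  [set S | S \in unitmx /\ S^T *m A *m S = A].

Definition GLset n : set 'M[K]_n := [set S | S \in unitmx].

Definition Oset n : set 'M[K]_n := [set S | S^T *m S = 1%:M].

Definition SLset n : set 'M[K]_n := [set S | \det S = 1].

Definition pm1 : set K := [set 1; -1].

Definition mx2 (a b c d : K) : 'M[K]_2 :=
  \matrix_(i, j) (nth [::] [:: [:: a; b]; [:: c; d]] i)`_j.

Definition mx3 (a b c d e f g h k : K) : 'M[K]_3 :=
  \matrix_(i, j)
    (nth [::] [:: [:: a; b; c]; [:: d; e; f]; [:: g; h; k]] i)`_j.

End IsometryGroups.

Arguments GLset : clear implicits.
Arguments Oset : clear implicits.
Arguments SLset : clear implicits.
Arguments pm1 : clear implicits.

(* Main.v *)
(* If N is invertible, a solution S of S^T (N (+) 0) S = N (+) 0 has a zero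
   upper right block.  For a direct sum A (+) E with E symmetric this is applied
   to N = A, when A is invertible and E = 0, or to the skew part N = A - A^T,
   since every isometry of a form is an isometry of its skew part.  It reduces
   the direct sums to 2x2 and 1x1 matrices.  In the two indecomposable 3x3 cases
   an isometry preserves the left and right kernels of the form, respectively
   the kernel of its skew part, which leaves a triangular system. *)
Require Import Defs.
From mathcomp Require Import all_boot all_order all_algebra.
From mathcomp Require Import classical_sets reals.
From mathcomp.real_closed Require Import complex.
From mathcomp Require Import ring.

Import GRing.Theory Num.Theory.
Local Open Scope ring_scope.
Local Open Scope classical_set_scope.

(** * Signs and first facts about isometry groups *)

Section Isometries.
Variable K : fieldType.

(** In this form a sign becomes a polynomial hypothesis that [ring] and [field] can use. *)
Lemma pm1P (d : K) : pm1 K d <-> d * d = 1.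
Proof.
split=> [[->|->]|dd]; rewrite ?mulrNN ?mulr1 //.
have /eqP : (d - 1) * (d + 1) = 0 by rewrite -subr_sqr expr2 dd expr1n subrr.
by rewrite mulf_eq0 subr_eq0 addr_eq0 => /orP[/eqP->|/eqP->]; [left|right].
Qed.

Lemma pm1_neq0 (d : K) : pm1 K d -> d != 0.
Proof.
move/pm1P=> dd; apply: contra_eq_neq dd => ->.
by rewrite mul0r eq_sym oner_neq0.
Qed.

Lemma ig0 n : ig (0 : 'M[K]_n) = GLset K n.
Proof.
by apply/seteqP; split=> S /= => [[] //|uS]; split=> //; rewrite mulmx0 mul0mx.
Qed.

Lemma ig1 n : ig (1%:M : 'M[K]_n) = Oset K n.
Proof.
apply/seteqP; split=> S /=; first by case=> _; rewrite mulmx1.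
by move=> SS; split; [case/mulmx1_unit: SS|rewrite mulmx1].
Qed.

Lemma ig_unit n (A S : 'M[K]_n) :
  A \in unitmx -> S^T *m A *m S = A -> S \in unitmx.
Proof. by move=> uA eqA; move: uA; rewrite -eqA unitmx_mul => /andP[]. Qed.

(** Transposing the equation shows that [S] preserves [A^T] as well; subtract. *)
Lemma ig_sub_tr n (A S : 'M[K]_n) :
  S^T *m A *m S = A -> S^T *m (A - A^T) *m S = A - A^T.
Proof.
move=> eqA; rewrite mulmxBr mulmxBl eqA; congr (_ - _).
by rewrite -[in RHS]eqA !trmx_mul trmxK mulmxA.
Qed.

(** * Isometries of block diagonal forms *)

Lemma ig_diag_block n k (B : 'M[K]_n) (v : 'M_(n, k)) (u : 'M_(k, n))
    (D : 'M_k) (A : 'M_n) (E : 'M_k) :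
  let S := block_mx B v u D in
  S^T *m block_mx A 0 0 E *m S =
  block_mx (B^T *m A *m B + u^T *m E *m u) (B^T *m A *m v + u^T *m E *m D)
           (v^T *m A *m B + D^T *m E *m u) (v^T *m A *m v + D^T *m E *m D).
Proof.
by rewrite /= tr_block_mx !mulmx_block !mulmx0 !addr0 !add0r.
Qed.

(** Write B and v for the upper blocks of [S]. The upper left block of the equation makes B an
    isometry of [N], so B^T N is invertible; the upper right block reads B^T N v = 0 and kills v. *)
Lemma ig_block_ursubmx0 n k (N : 'M[K]_n) (S : 'M[K]_(n + k)) :
  N \in unitmx ->
  S^T *m block_mx N 0 0 (0 : 'M_k) *m S = block_mx N 0 0 0 -> ursubmx S = 0.
Proof.
move=> uN; rewrite -[X in X^T](submxK S) -[X in _ *m X](submxK S) ig_diag_block.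
rewrite !mulmx0 !mul0mx !addr0 => /eq_block_mx[eqN eq0 _ _].
have uBN : (ulsubmx S)^T *m N \in unitmx.
  by rewrite unitmx_mul unitmx_tr (ig_unit _ _ _ uN eqN).
by rewrite -[LHS](mulKmx uBN) eq0 mulmx0.
Qed.

(** Passing to the skew part turns the symmetric corner [E] into 0. *)
Lemma ig_block_tr_ursubmx0 n k (A : 'M[K]_n) (E : 'M_k) (S : 'M[K]_(n + k)) :
  A - A^T \in unitmx -> E^T = E ->
  S^T *m block_mx A 0 0 E *m S = block_mx A 0 0 E -> ursubmx S = 0.
Proof.
move=> uN symE /ig_sub_tr.
rewrite tr_block_mx !trmx0 symE opp_block_mx add_block_mx !subr0 subrr.
exact: ig_block_ursubmx0.
Qed.

(** Both alternatives occur: an identity block is invertible with zero skew part, while the block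
    with rows (0, 1) and (0, 0), the case lambda = 0, is singular with invertible skew part. *)
Lemma ig_block0 n k (A : 'M[K]_n) :
  (A \in unitmx) || (A - A^T \in unitmx) ->
  ig (block_mx A 0 0 (0 : 'M_k)) =
  [set S | exists (B : 'M_n) (u : 'M_(k, n)) (D : 'M_k),
     [/\ ig A B, D \in unitmx & S = block_mx B 0 u D]].
Proof.
move=> uA; apply/seteqP; split=> S /=.
- case=> uS eqS; have ur0 : ursubmx S = 0.
    case/orP: uA => uA; first exact: ig_block_ursubmx0 uA eqS.
    by apply: ig_block_tr_ursubmx0 uA _ eqS; rewrite trmx0.
  have defS : S = block_mx (ulsubmx S) 0 (dlsubmx S) (drsubmx S).
    by rewrite -ur0 submxK.
  move: (ulsubmx S) (dlsubmx S) (drsubmx S) defS => B u D defS.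
  exists B, u, D; move: eqS uS; rewrite defS ig_diag_block.
  rewrite !mulmx0 !mul0mx !addr0 => /eq_block_mx[eqA _ _ _].
  by rewrite !unitmxE det_lblock unitrM => /andP[].
case=> B [u [D [[uB eqA] uD ->]]]; split.
  by rewrite unitmxE det_lblock unitrM -!unitmxE uB uD.
by rewrite ig_diag_block eqA trmx0 !(mulmx0, mul0mx) !addr0.
Qed.

Lemma ig_block n k (A : 'M[K]_n) (E : 'M_k) :
  A - A^T \in unitmx -> E \in unitmx -> E^T = E ->
  ig (block_mx A 0 0 E) =
  [set S | exists (B : 'M_n) (D : 'M_k),
     [/\ ig A B, ig E D & S = block_mx B 0 0 D]].
Proof.
move=> uA uE symE; apply/seteqP; split=> S /=.
- case=> uS eqS; have ur0 := ig_block_tr_ursubmx0 _ _ _ _ _ uA symE eqS.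
  have defS : S = block_mx (ulsubmx S) 0 (dlsubmx S) (drsubmx S).
    by rewrite -ur0 submxK.
  move: (ulsubmx S) (dlsubmx S) (drsubmx S) defS => B u D defS.
  move: eqS uS; rewrite defS ig_diag_block.
  rewrite trmx0 !(mulmx0, mul0mx) !add0r => /eq_block_mx[eqA _ eq0 eqE].
  rewrite unitmxE det_lblock unitrM -!unitmxE => /andP[uB uD].
  (* The lower left block of the equation is D^T E u = 0, with D and E invertible. *)
  have u0 : u = 0.
    have uDE : D^T *m E \in unitmx by rewrite unitmx_mul unitmx_tr uD.
    by rewrite -[LHS](mulKmx uDE) eq0 mulmx0.
  exists B, D; split=> //; last by rewrite u0.
  by split=> //; rewrite -[RHS]eqA u0 mulmx0 addr0.
case=> B [D [[uB eqA] [uD eqE] ->]]; split.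
  by rewrite unitmxE det_lblock unitrM -!unitmxE uB uD.
by rewrite ig_diag_block eqA eqE !trmx0 !(mulmx0, mul0mx) !addr0 add0r.
Qed.

Lemma ig1_scalar :
  ig (1%:M : 'M[K]_1) = [set S | exists2 d, pm1 K d & S = d%:M].
Proof.
rewrite ig1; apply/seteqP; split=> S /=.
  move=> SS; exists (S 0 0); last exact: mx11_scalar.
  apply/pm1P; move: SS; rewrite /Oset /= [S]mx11_scalar tr_scalar_mx.
  by rewrite -scalar_mxM => /matrixP/(_ 0 0); rewrite !mxE eqxx.
by case=> d /pm1P dd ->; rewrite /Oset /= tr_scalar_mx -scalar_mxM dd.
Qed.

(** * Coordinates for 2x2 matrices *)

Lemma mx2_eta (S : 'M[K]_2) : exists a b c d, S = mx2 a b c d.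
Proof.
exists (S 0 0), (S 0 1), (S 1 0), (S 1 1); apply/matrixP=> i j; rewrite mxE.
by case: i j => [[|[|//]] ?] [[|[|//]] ?]; congr (S _ _); apply/val_inj.
Qed.

Lemma mx2_inj (a b c d a' b' c' d' : K) :
  mx2 a b c d = mx2 a' b' c' d' -> [/\ a = a', b = b', c = c' & d = d'].
Proof.
by move/matrixP=> E; split;
  [have := E 0 0|have := E 0 1|have := E 1 0|have := E 1 1]; rewrite !mxE.
Qed.

Lemma mul_mx2 (a b c d a' b' c' d' : K) :
  mx2 a b c d *m mx2 a' b' c' d' =
  mx2 (a * a' + b * c') (a * b' + b * d') (c * a' + d * c') (c * b' + d * d').
Proof.
apply/matrixP=> i j; rewrite !mxE !big_ord_recl big_ord0 !mxE addr0.
by case: i j => [[|[|//]] ?] [[|[|//]] ?].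
Qed.

Lemma tr_mx2 (a b c d : K) : (mx2 a b c d)^T = mx2 a c b d.
Proof.
by apply/matrixP=> i j; rewrite !mxE; case: i j => [[|[|//]] ?] [[|[|//]] ?].
Qed.

Lemma sub_mx2 (a b c d a' b' c' d' : K) :
  mx2 a b c d - mx2 a' b' c' d' = mx2 (a - a') (b - b') (c - c') (d - d').
Proof.
by apply/matrixP=> i j; rewrite !mxE; case: i j => [[|[|//]] ?] [[|[|//]] ?].
Qed.

Lemma scale_mx2 (k a b c d : K) :
  k *: mx2 a b c d = mx2 (k * a) (k * b) (k * c) (k * d).
Proof.
by apply/matrixP=> i j; rewrite !mxE; case: i j => [[|[|//]] ?] [[|[|//]] ?].
Qed.

Lemma det_mx2 (a b c d : K) : \det (mx2 a b c d) = a * d - b * c.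
Proof.
rewrite (expand_det_row _ 0) !big_ord_recl big_ord0 /cofactor !det_mx11 !mxE /=.
by rewrite expr0 expr1; ring.
Qed.

Lemma mx2_0 : mx2 0 0 0 0 = 0 :> 'M[K]_2.
Proof.
by apply/matrixP=> i j; rewrite !mxE; case: i j => [[|[|//]] ?] [[|[|//]] ?].
Qed.

Lemma mx2_1 : mx2 1 0 0 1 = 1%:M :> 'M[K]_2.
Proof.
by apply/matrixP=> i j; rewrite !mxE; case: i j => [[|[|//]] ?] [[|[|//]] ?].
Qed.

Lemma mx2_unit (a b c d : K) : (mx2 a b c d \in unitmx) = (a * d - b * c != 0).
Proof. by rewrite unitmxE det_mx2 unitfE. Qed.

(** The skew part has determinant (b - c)^2. *)
Lemma mx2_sub_tr_unit (a b c d : K) :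
  b != c -> mx2 a b c d - (mx2 a b c d)^T \in unitmx.
Proof.
rewrite -subr_eq0 => bc; rewrite tr_mx2 sub_mx2 mx2_unit !subrr mul0r sub0r.
by rewrite -[c - b]opprB mulrN opprK mulf_neq0.
Qed.

(** Each equation has a single coefficient of the form on its right, so rewriting that coefficient
    backwards in a goal leaves an identity for [ring]. *)
Lemma ig_mx2P (a b c d x y z t : K) :
  (mx2 x y z t)^T *m mx2 a b c d *m mx2 x y z t = mx2 a b c d <->
  [/\ a * x * x + b * x * z + c * z * x + d * z * z = a,
      a * x * y + b * x * t + c * z * y + d * z * t = b,
      a * y * x + b * y * z + c * t * x + d * t * z = c &
      a * y * y + b * y * t + c * t * y + d * t * t = d].
Proof.
rewrite tr_mx2 !mul_mx2; split.
  by move/mx2_inj=> [e1 e2 e3 e4]; split;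
    [rewrite -[RHS]e1|rewrite -[RHS]e2|rewrite -[RHS]e3|rewrite -[RHS]e4]; ring.
by case=> e1 e2 e3 e4; congr mx2;
  [rewrite -[RHS]e1|rewrite -[RHS]e2|rewrite -[RHS]e3|rewrite -[RHS]e4]; ring.
Qed.

(** * Isometry groups of the 2x2 forms *)

Lemma ig_mx2_diag10 :
  ig (mx2 1 0 0 0 : 'M[K]_2) =
  [set S | exists d x c, [/\ pm1 K d, c != 0 & S = mx2 d 0 x c]].
Proof.
apply/seteqP; split=> S /=.
  case: (mx2_eta S) => x [y [z [t ->]]] [uS /ig_mx2P[e1 _ _ e4]].
  have {e1} xx : x * x = 1 by rewrite -[RHS]e1; ring.
  have {e4} /eqP : y * y = 0 by rewrite -[RHS]e4; ring.
  rewrite mulf_eq0 orbb => /eqP y0; move: uS; rewrite y0 mx2_unit mul0r subr0.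
  rewrite mulf_eq0 negb_or => /andP[_ t0].
  by exists x, z, t; split=> //; apply/pm1P.
case=> d [x [c [pd c0 ->]]]; split.
  by rewrite mx2_unit mul0r subr0 mulf_neq0 // pm1_neq0.
by apply/ig_mx2P; move/pm1P: pd => dd; split; ring: dd.
Qed.

(** For J the matrix of the form and any 2x2 matrix S, S^T J S = (det S) J. *)
Lemma ig_mx2_symplectic : ig (mx2 0 1 (-1) 0 : 'M[K]_2) = SLset K 2.
Proof.
apply/seteqP; split=> S; case: (mx2_eta S) => x [y [z [t ->]]];
  rewrite /SLset /= det_mx2.
  by case=> _ /ig_mx2P[_ e2 _ _]; rewrite -[RHS]e2; ring.
move=> eqd; split; first by rewrite mx2_unit eqd oner_neq0.
apply/ig_mx2P; split; [ring|rewrite -[RHS]eqd; ring| |ring].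
by apply: oppr_inj; rewrite opprK -[RHS]eqd; ring.
Qed.

(** The diagonal equations carry the factor lam + 1 and give x z = y t = 0. The difference of the
    off-diagonal ones carries lam - 1 and gives det S = 1. It remains to exclude the antidiagonal
    solutions. *)
Lemma ig_mx2_lambda (lam : K) : lam != 1 -> lam != -1 ->
  ig (mx2 0 1 lam 0) = [set S | exists c, c != 0 /\ S = mx2 c 0 0 c^-1].
Proof.
rewrite -subr_eq0 => lam1; rewrite -addr_eq0 => lamN1.
apply/seteqP; split=> S /=.
  case: (mx2_eta S) => x [y [z [t ->]]] [_ /ig_mx2P[e1 e2 e3 e4]].
  have {e4} yt : y * t = 0.
    by apply: (mulfI lamN1); rewrite mulr0 -[RHS]e4; ring.
  have {e1} xz : x * z = 0.
    by apply: (mulfI lamN1); rewrite mulr0 -[RHS]e1; ring.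
  have dt : x * t - y * z = 1.
    apply: (mulfI lam1); rewrite mulr1 -[in RHS]e3 -[X in _ = _ - X]e2; ring.
  have y0 : y = 0.
    (* This is y det S, expanded so that y t = 0 applies. *)
    have -> : y = x * (y * t) - y * (y * z).
      by rewrite -[LHS]mulr1 -dt; ring.
    have -> : y * z = - 1 + x * t by rewrite -[in RHS]dt; ring.
    (* Eliminating x t from the two off-diagonal equations leaves (lam^2 - 1) y z = 0. *)
    have /eqP : (y * z) * ((lam - 1) * (lam + 1)) = 0.
      have -> : y * z * ((lam - 1) * (lam + 1)) =
                lam * (y * z * lam + x * t) - (y * z + lam * (x * t)) by ring.
      have -> : y * z * lam + x * t = 1 by rewrite -[RHS]e2; ring.
      have -> : y * z + lam * (x * t) = lam by rewrite -[RHS]e3; ring.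
      by rewrite mulr1 subrr.
    rewrite !mulf_eq0 (negPf lam1) (negPf lamN1) !orbF -mulf_eq0 => /eqP yz.
    by move: dt; rewrite yz subr0 => ->; rewrite yt; ring.
  move: dt; rewrite y0 mul0r subr0 => xt.
  have x0 : x != 0.
    by apply: contra_eq_neq xt => ->; rewrite mul0r eq_sym oner_neq0.
  exists x; split=> //; congr mx2; last by apply: (mulfI x0); rewrite mulfV.
  by apply: (mulfI x0); rewrite xz mulr0.
case=> c [c0 ->]; split.
  by rewrite mx2_unit mulfV // mul0r subr0 oner_neq0.
by apply/ig_mx2P; split; field.
Qed.

(** The quadratic form attached to this matrix is the square of the second coordinate, so the
    diagonal equations are z^2 = 0 and t^2 = 1. Then x t = 1 forces x = t. *)
Lemma ig_mx2_jordan :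
  ig (mx2 0 (-1) 1 1 : 'M[K]_2) =
  [set S | exists d x, pm1 K d /\ S = mx2 d x 0 d].
Proof.
apply/seteqP; split=> S /=.
  case: (mx2_eta S) => x [y [z [t ->]]] [_ /ig_mx2P[e1 e2 e3 e4]].
  have {e1} /eqP : z * z = 0 by rewrite -[RHS]e1; ring.
  rewrite mulf_eq0 orbb => /eqP z0; move: e2 e4; rewrite z0 => e2 e4.
  have {e4} tt : t * t = 1 by rewrite -[RHS]e4; ring.
  have {e2} xt : x * t = 1 by rewrite -[RHS]opprK -e2; ring.
  have xE : x = t by rewrite -[LHS]mulr1 -tt mulrA xt mul1r.
  by exists t, y; rewrite xE; split=> //; apply/pm1P.
case=> d [x [/pm1P dd ->]]; split.
  by rewrite mx2_unit dd mulr0 subr0 oner_neq0.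
by apply/ig_mx2P; split; ring: dd.
Qed.

(** * Coordinates and block forms for 3x3 matrices *)

Lemma mx3_eta (S : 'M[K]_3) :
  exists a b c d e f g h k, S = mx3 a b c d e f g h k.
Proof.
exists (S 0 0), (S 0 1), (S 0 2), (S 1 0), (S 1 1), (S 1 2).
exists (S 2 0), (S 2 1), (S 2 2); apply/matrixP=> i j; rewrite mxE.
by case: i j => [[|[|[|//]]] ?] [[|[|[|//]]] ?]; congr (S _ _); apply/val_inj.
Qed.

Lemma mx3_inj (a b c d e f g h k a' b' c' d' e' f' g' h' k' : K) :
  mx3 a b c d e f g h k = mx3 a' b' c' d' e' f' g' h' k' ->
  [/\ a = a', b = b' & c = c'] /\ [/\ d = d', e = e' & f = f'] /\
  [/\ g = g', h = h' & k = k'].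
Proof.
move/matrixP=> E; do ![split]; [have := E 0 0|have := E 0 1|have := E 0 2|
  have := E 1 0|have := E 1 1|have := E 1 2|
  have := E 2 0|have := E 2 1|have := E 2 2]; by rewrite !mxE.
Qed.

Lemma mul_mx3 (a b c d e f g h k a' b' c' d' e' f' g' h' k' : K) :
  mx3 a b c d e f g h k *m mx3 a' b' c' d' e' f' g' h' k' =
  mx3 (a * a' + b * d' + c * g') (a * b' + b * e' + c * h')
      (a * c' + b * f' + c * k')
      (d * a' + e * d' + f * g') (d * b' + e * e' + f * h')
      (d * c' + e * f' + f * k')
      (g * a' + h * d' + k * g') (g * b' + h * e' + k * h')
      (g * c' + h * f' + k * k').
Proof.
apply/matrixP=> i j; rewrite !mxE !big_ord_recl big_ord0 !mxE addr0 addrA.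
by case: i j => [[|[|[|//]]] ?] [[|[|[|//]]] ?].
Qed.

Lemma tr_mx3 (a b c d e f g h k : K) :
  (mx3 a b c d e f g h k)^T = mx3 a d g b e h c f k.
Proof.
apply/matrixP=> i j; rewrite !mxE.
by case: i j => [[|[|[|//]]] ?] [[|[|[|//]]] ?].
Qed.

Lemma scale_mx3 (l a b c d e f g h k : K) :
  l *: mx3 a b c d e f g h k =
  mx3 (l * a) (l * b) (l * c) (l * d) (l * e) (l * f) (l * g) (l * h) (l * k).
Proof.
apply/matrixP=> i j; rewrite !mxE.
by case: i j => [[|[|[|//]]] ?] [[|[|[|//]]] ?].
Qed.

(** The equation is well typed because 2 + 1 reduces to 3. *)
Lemma mx3_block (a b c d e f g h k : K) :
  mx3 a b c d e f g h k =
  block_mx (mx2 a b d e) (\col_i [:: c; f]`_i) (\row_j [:: g; h]`_j)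
           (k%:M : 'M_1).
Proof.
apply/matrixP=> i j; rewrite !mxE.
by case: splitP => i' /= ->; rewrite !mxE; case: splitP => j' /= ->;
  rewrite !mxE;
  try (case: i' => [[|[|//]] ?]); try (case: j' => [[|[|//]] ?]);
  rewrite ?(ord1 i') ?(ord1 j').
Qed.

Lemma mx3_1 : mx3 1 0 0 0 1 0 0 0 1 = 1%:M :> 'M[K]_3.
Proof.
apply/matrixP=> i j; rewrite !mxE.
by case: i j => [[|[|[|//]]] ?] [[|[|[|//]]] ?].
Qed.

Lemma mx3_diag (a b d e k : K) :
  mx3 a b 0 d e 0 0 0 k = block_mx (mx2 a b d e) 0 0 (k%:M : 'M_1).
Proof.
have col0 : \col_(i < 2) [:: 0; 0 : K]`_i = 0.
  by apply/matrixP=> i j; rewrite !mxE; case: i => [[|[|//]] ?].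
have row0 : \row_(j < 2) [:: 0; 0 : K]`_j = 0.
  by apply/matrixP=> i j; rewrite !mxE; case: j => [[|[|//]] ?].
by rewrite mx3_block col0 row0.
Qed.

Lemma mx3_lblock (a b d e c : K) (u : 'rV_2) :
  block_mx (mx2 a b d e) 0 u (c%:M : 'M_1) =
  mx3 a b 0 d e 0 (u 0 0) (u 0 1) c.
Proof.
rewrite mx3_block; congr (block_mx _ _ _ _); apply/matrixP=> i j; rewrite !mxE.
  by case: i => [[|[|//]] ?].
by rewrite ord1; case: j => [[|[|//]] ?]; congr (u _ _); apply/val_inj.
Qed.

(** * Isometry groups of the 3x3 direct sums *)

Lemma ig_mx3_block0 (a b d e : K) :
  let A := mx2 a b d e in (A \in unitmx) || (A - A^T \in unitmx) ->
  ig (mx3 a b 0 d e 0 0 0 0) =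
  [set S | exists (B : 'M_2) (u : 'rV_2) (c : K),
     [/\ ig A B, c != 0 & S = block_mx B 0 u (c%:M : 'M_1)]].
Proof.
move=> A uA; rewrite mx3_diag raddf0 (ig_block0 2 1 A uA).
apply/seteqP; split=> S /=.
  case=> B [u [D [igB uD ->]]]; exists B, u, (D 0 0); split=> //.
    by move: uD; rewrite unitmxE det_mx11 unitfE.
  by rewrite -mx11_scalar.
case=> B [u [c [igB c0 ->]]]; exists B, u, c%:M; split=> //.
by rewrite unitmxE det_scalar1 unitfE.
Qed.

(** The hypothesis says that the 2x2 block is not symmetric, which in size two already makes its
    skew part invertible. *)
Lemma ig_mx3_block1 (a b d e : K) : b != d ->
  ig (mx3 a b 0 d e 0 0 0 1) =
  [set S | exists (B : 'M_2) (c : K),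
     [/\ ig (mx2 a b d e) B, pm1 K c & S = block_mx B 0 0 (c%:M : 'M_1)]].
Proof.
move=> /mx2_sub_tr_unit-/(_ a e) uA.
rewrite mx3_diag (ig_block 2 1 _ _ uA (unitmx1 _ _) (trmx1 _ _)) ig1_scalar.
apply/seteqP; split=> S /=.
  by case=> B [D [igB [c pc ->] ->]]; exists B, c.
by case=> B [c [igB pc ->]]; exists B, c%:M; split=> //; exists c.
Qed.

Lemma ig_mx3_diag100 :
  ig (mx3 1 0 0 0 0 0 0 0 0 : 'M[K]_3) =
  [set S | exists (d : K) (u : 'cV[K]_2) (B : 'M[K]_2),
     [/\ pm1 K d, \det B != 0 & S = block_mx (d%:M : 'M[K]_1) 0 u B]].
Proof.
(* The splitting is 1 + 2 here, so that the nondegenerate block comes first. *)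
have -> : mx3 1 0 0 0 0 0 0 0 0 = block_mx (1%:M : 'M[K]_1) 0 0 (0 : 'M_2).
  apply/matrixP=> i j; rewrite !mxE.
  by case: splitP => i' /= ->; rewrite !mxE; case: splitP => j' /= ->;
    rewrite !mxE ?ord1 //; try (case: i' => [[|[|//]] ?]);
    try (case: j' => [[|[|//]] ?]).
rewrite (ig_block0 1 2) ?unitmx1 // ig1_scalar; apply/seteqP; split=> S /=.
  case=> B [u [D [[d pd ->] uD ->]]]; exists d, u, D; split=> //.
  by rewrite -unitfE -unitmxE.
case=> d [u [B [pd uB ->]]]; exists d%:M, u, B; split=> //; first by exists d.
by rewrite unitmxE unitfE.
Qed.

(** * The two indecomposable 3x3 forms *)

Lemma ig_mx3_nilpotent :
  ig (mx3 0 1 0 0 0 1 0 0 0 : 'M[K]_3) =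
  [set S | exists c a, c != 0 /\ S = mx3 c a 0 0 c^-1 0 0 (- a) c].
Proof.
apply/seteqP; split=> S /=.
  case=> uS eqS; have [T TS] : exists T, S *m T = 1%:M.
    by exists (invmx S); rewrite mulmxV.
  have ST := mulmx1C TS.
  (* The isometry S preserves the left and right kernels of the form. *)
  have eqr : S^T *m mx3 0 1 0 0 0 1 0 0 0 = mx3 0 1 0 0 0 1 0 0 0 *m T.
    by rewrite -[LHS]mulmx1 -TS mulmxA eqS.
  have eql : mx3 0 1 0 0 0 1 0 0 0 *m S = T^T *m mx3 0 1 0 0 0 1 0 0 0.
    by rewrite -[in RHS]eqS !mulmxA -trmx_mul TS trmx1 mul1mx.
  case: (mx3_eta S) eqS eqr eql => a [b [c [d [e [f [g [h [k ->]]]]]]]].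
  case: (mx3_eta T) => a' [b' [c' [d' [e' [f' [g' [h' [k' ->]]]]]]]].
  rewrite !tr_mx3 !mul_mx3 !(mul0r, mulr0, mul1r, mulr1, add0r, addr0).
  move=> /mx3_inj[[_ e12 _] [[_ e22 e23] _]].
  move=> /mx3_inj[_ [_ [_ c0 f0]]] /mx3_inj[[d0 _ _] [[g0 _ _] _]].
  (* The outer columns of [S] are now multiples of basis vectors. What remains is a e = 1, e (b + h)
     = 0 and e k = 1. *)
  move: e12 e22 e23; rewrite c0 d0 f0 g0 !(mul0r, mulr0, add0r, addr0).
  move=> ae beh ek.
  have a0 : a != 0.
    by apply: contra_eq_neq ae => ->; rewrite mul0r eq_sym oner_neq0.
  have e0 : e != 0.
    by apply: contra_eq_neq ae => ->; rewrite mulr0 eq_sym oner_neq0.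
  exists a, b; split=> //; congr mx3; last first.
  - by apply: (mulfI e0); rewrite ek mulrC ae.
  - apply/eqP; rewrite -addr_eq0; apply/eqP/(mulfI e0).
    by rewrite mulr0 -beh; ring.
  - by apply: (mulfI a0); rewrite ae mulfV.
case=> c [a [c0 ->]]; split; last by rewrite tr_mx3 !mul_mx3; congr mx3; field.
(* The inverse lies in the same family, with c and a replaced by 1/c and -a. *)
have /mulmx1_unit[] // : mx3 c a 0 0 c^-1 0 0 (- a) c *m
    mx3 c^-1 (- a) 0 0 c 0 0 a c^-1 = 1%:M.
by rewrite mul_mx3 -mx3_1; congr mx3; field.
Qed.

(** The skew difference of the matrix and its transpose is, up to sign, twice the determinant of the
    last two coordinates. After division by 2, an isometry must have 0, 0, 1 as the 2x2 minors of
    its last two rows. *)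
Lemma ig_mx3_unipotent : (2 : K) != 0 ->
  ig (mx3 0 0 1 0 (-1) (-1) 1 1 0 : 'M[K]_3) =
  [set S | exists d a, pm1 K d /\
     S = d *: mx3 1 a (a ^+ 2 / 2) 0 1 a 0 0 1].
Proof.
move=> two0; apply/seteqP; split=> S /=; last first.
  case=> d [a [/pm1P dd ->]]; rewrite scale_mx3; split.
    (* The inverse is the member of the family with the same sign and parameter -a. *)
    have /mulmx1_unit[] // : mx3 (d * 1) (d * a) (d * (a ^+ 2 / 2))
        (d * 0) (d * 1) (d * a) (d * 0) (d * 0) (d * 1) *m
        mx3 d (- (d * a)) (d * (a ^+ 2 / 2)) 0 d (- (d * a)) 0 0 d = 1%:M.
    by rewrite mul_mx3 -mx3_1; congr mx3; field: dd.
  by rewrite tr_mx3 !mul_mx3; congr mx3; field: dd.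
case: (mx3_eta S) => a [b [c [d [e [f [g [h [k ->]]]]]]]] [_].
rewrite tr_mx3 !mul_mx3.
case/mx3_inj=> [[e11 e12 e13] [[e21 e22 e23] [e31 e32 e33]]].
(* The skew part of the form has kernel spanned by the first basis vector. *)
have m12 : d * h = e * g.
  apply: (mulfI two0); apply/eqP; rewrite -subr_eq0; apply/eqP.
  rewrite -[RHS](subrr (0 : K)).
  by rewrite -[X in _ = X - _]e21 -[X in _ = _ - X]e12; ring.
have m13 : d * k = f * g.
  apply: (mulfI two0); apply/eqP; rewrite -subr_eq0; apply/eqP.
  rewrite -[RHS](subrr (1 : K)).
  by rewrite -[X in _ = X - _]e31 -[X in _ = _ - X]e13; ring.
have m23 : e * k - f * h = 1.
  apply: (mulfI two0).
  have -> : 2 * 1 = 1 - (-1) :> K by ring.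
  by rewrite -[X in _ = X - _]e32 -[X in _ = _ - X]e23; ring.
(* Multiply d by the minor equal to 1: d = e (d k) - f (d h), and the two vanishing minors turn this
   into e f g - f e g. The argument for g is the same. *)
have d0 : d = 0.
  transitivity (e * (d * k) - f * (d * h)); last by rewrite m12 m13; ring.
  by rewrite -[LHS]mulr1 -m23; ring.
have g0 : g = 0.
  transitivity (k * (e * g) - h * (f * g)); last by rewrite -m12 -m13; ring.
  by rewrite -[LHS]mulr1 -m23; ring.
move: e12 e13 e22 e23 e33 m23; rewrite {}d0 {}g0 => e12 e13 e22 e23 e33 m23.
have ak : a * k = 1 by rewrite -[RHS]e13; ring.
have a0 : a != 0.
  by apply: contra_eq_neq ak => ->; rewrite mul0r eq_sym oner_neq0.
have h0 : h = 0 by apply: (mulfI a0); rewrite mulr0 -[RHS]e12; ring.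
move: e22 e23 m23; rewrite {}h0 => e22 e23 m23.
have ee : e * e = 1 by rewrite -[RHS]opprK -e22; ring.
have ek : e * k = 1 by rewrite -[RHS]m23; ring.
have kE : k = e by rewrite -[LHS]mul1r -ee -mulrA ek mulr1.
have aE : a = e by rewrite -[LHS]mulr1 -ee mulrA -kE ak mul1r kE.
have e0 : e != 0 by apply: pm1_neq0; apply/pm1P.
have bf : b = f.
  apply: (mulfI e0); apply/eqP; rewrite -subr_eq0; apply/eqP.
  transitivity (-1 + e * k); last by rewrite ek addNr.
  by rewrite -[X in _ = X + _]e23 kE; ring.
have c2 : 2 * (e * c) = f ^+ 2.
  apply/eqP; rewrite -subr_eq0; apply/eqP.
  by rewrite -[RHS]e33 kE; ring.
(* Since e^2 = 1, factoring the sign e out of [S] multiplies the superdiagonal entry f by e. *)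
exists e, (e * f); split; first by apply/pm1P.
rewrite scale_mx3 !mulr0 !mulr1 mulrA ee mul1r; congr mx3 => //.
apply: (mulfI two0); apply: (mulfI e0).
transitivity (2 * (e * c)); first by ring.
by rewrite c2; field: ee.
Qed.

End Isometries.

(** * The classification over the complex numbers *)

Theorem theorem6p7 (R : realType) :
  let C : fieldType := R[i] in
  ([/\ ig (mx2 0 0
               0 0 : 'M[C]_2) = GLset C 2,
       ig (mx2 1 0
               0 0 : 'M[C]_2) =
         [set S | exists d x c : C, [/\ pm1 C d, c != 0 &
            S = mx2 d 0
                    x c]],
       ig (mx2 1 0
               0 1 : 'M[C]_2) = Oset C 2,
       ig (mx2 0    1
               (-1) 0 : 'M[C]_2) = SLset C 2
     & (forall lam : C, lam != 1 -> lam != -1 ->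
        ig (mx2 0   1
                lam 0) =
          [set S | exists c : C, c != 0 /\
             S = mx2 c 0
                     0 c^-1])
       /\
       ig (mx2 0 (-1)
               1 1 : 'M[C]_2) =
         [set S | exists d x : C, pm1 C d /\
            S = d *: mx2 1 x
                         0 1]])
  /\
  ([/\ ig (0 : 'M[C]_3) = GLset C 3,
       ig (mx3 1 0 0
               0 0 0
               0 0 0 : 'M[C]_3) =
         [set S | exists (d : C) (u : 'cV[C]_2) (B : 'M[C]_2),
            [/\ pm1 C d, \det B != 0 &
              S = block_mx (d%:M : 'M[C]_1) 0
                           u                B]],
       ig (mx3 1 0 0
               0 1 0
               0 0 0 : 'M[C]_3) =
         [set S | exists (A : 'M[C]_2) (u : 'rV[C]_2) (c : C),
            [/\ A^T *m A = 1%:M, c != 0 &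
              S = block_mx A 0
                           u (c%:M : 'M[C]_1)]]
     & ig (1%:M : 'M[C]_3) = Oset C 3]
   /\
   [/\ ig (mx3 0    1 0
               (-1) 0 0
               0    0 0 : 'M[C]_3) =
         [set S | exists (A : 'M[C]_2) (u : 'rV[C]_2) (c : C),
            [/\ \det A = 1, c != 0 &
              S = block_mx A 0
                           u (c%:M : 'M[C]_1)]],
       ig (mx3 0    1 0
               (-1) 0 0
               0    0 1 : 'M[C]_3) =
         [set S | exists (A : 'M[C]_2) (d : C),
            [/\ \det A = 1, pm1 C d &
              S = block_mx A 0
                           0 (d%:M : 'M[C]_1)]],
       (forall lam : C, lam != 1 -> lam != -1 ->
        ig (mx3 0   1 0
                lam 0 0
                0   0 0) =
          [set S | exists c c' x y : C, [/\ c != 0, c' != 0 &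
             S = mx3 c 0    0
                     0 c^-1 0
                     x y    c']])
     & (forall lam : C, lam != 1 -> lam != -1 ->
        ig (mx3 0   1 0
                lam 0 0
                0   0 1) =
          [set S | exists c d : C, [/\ c != 0, pm1 C d &
             S = mx3 c 0    0
                     0 c^-1 0
                     0 0    d]])]
   /\
   [/\ ig (mx3 0 (-1) 0
               1 1    0
               0 0    0 : 'M[C]_3) =
         [set S | exists delta x y z c : C, [/\ pm1 C delta, c != 0 &
            S = mx3 delta x     0
                    0     delta 0
                    y     z     c]],
       ig (mx3 0 (-1) 0
               1 1    0
               0 0    1 : 'M[C]_3) =
         [set S | exists delta x d : C, [/\ pm1 C delta, pm1 C d &
            S = mx3 delta x     0
                    0     delta 0
                    0     0     d]],
       ig (mx3 0 1 0
               0 0 1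
               0 0 0 : 'M[C]_3) =
         [set S | exists c a : C, c != 0 /\
            S = mx3 c a     0
                    0 c^-1  0
                    0 (- a) c]
     & ig (mx3 0 0    1
               0 (-1) (-1)
               1 1    0 : 'M[C]_3) =
         [set S | exists d a : C, pm1 C d /\
            S = d *: mx3 1 a (a ^+ 2 / 2)
                         0 1 a
                         0 0 1]]).
Proof.
have C2 : (2 : R[i]) != 0 by rewrite pnatr_eq0.
split; [split|split; [split|split; split]].
- by rewrite mx2_0 ig0.
- exact: ig_mx2_diag10.
- by rewrite mx2_1 ig1.
- exact: ig_mx2_symplectic.
- split; first exact: ig_mx2_lambda.
  (* Factoring out the sign d replaces the corner x by d x. This is an involution because d^2 = 1,
     so one witness serves both inclusions. *)
  rewrite ig_mx2_jordan; apply/seteqP; split=> S /= [d [x [pd ->]]].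
    exists d, (d * x); split=> //.
    by rewrite scale_mx2 mulr1 mulr0 mulrA; move/pm1P: pd => ->; rewrite mul1r.
  by exists d, (d * x); rewrite scale_mx2 mulr1 mulr0.
- by rewrite ig0.
- exact: ig_mx3_diag100.
- by rewrite ig_mx3_block0 mx2_1 ?unitmx1 // ig1.
- exact: ig1.
- by rewrite ig_mx3_block0 ?ig_mx2_symplectic ?mx2_sub_tr_unit ?orbT //
             eq_sym eqNr oner_neq0.
- by rewrite ig_mx3_block1 ?ig_mx2_symplectic // eq_sym eqNr oner_neq0.
- move=> lam lam1 lamN1.
  (* The skew part is used, since lam = 0 makes the block itself singular. *)
  rewrite ig_mx3_block0 ?mx2_sub_tr_unit ?orbT // 1?eq_sym //.
  rewrite ig_mx2_lambda //.
  apply/seteqP; split=> S /=.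
    case=> B [u [c' [[c [c0 ->]] c'0 ->]]].
    by exists c, c', (u 0 0), (u 0 1); rewrite mx3_lblock.
  case=> c [c' [x [y [c0 c'0 ->]]]].
  exists (mx2 c 0 0 c^-1), (\row_j [:: x; y]`_j), c'; split=> //.
    by exists c.
  by rewrite mx3_lblock !mxE.
- move=> lam lam1 lamN1.
  rewrite ig_mx3_block1 // 1?eq_sym //.
  rewrite ig_mx2_lambda //.
  apply/seteqP; split=> S /=.
    case=> B [d [[c [c0 ->]] pd ->]].
    by exists c, d; rewrite mx3_diag.
  case=> c [d [c0 pd ->]].
  exists (mx2 c 0 0 c^-1), d; split=> //; first by exists c.
  by rewrite mx3_diag.
- rewrite ig_mx3_block0 ?mx2_sub_tr_unit ?orbT ?eqNr ?oner_neq0 //.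
  rewrite ig_mx2_jordan.
  apply/seteqP; split=> S /=.
    case=> B [u [c [[d [x [pd ->]]] c0 ->]]].
    by exists d, x, (u 0 0), (u 0 1), c; rewrite mx3_lblock.
  case=> d [x [y [z [c [pd c0 ->]]]]].
  exists (mx2 d x 0 d), (\row_j [:: y; z]`_j), c; split=> //.
    by exists d, x.
  by rewrite mx3_lblock !mxE.
- rewrite ig_mx3_block1 ?eqNr ?oner_neq0 // ig_mx2_jordan.
  apply/seteqP; split=> S /=.
    case=> B [d' [[d [x [pd ->]]] pd' ->]].
    by exists d, x, d'; rewrite mx3_diag.
  case=> d [x [d' [pd pd' ->]]].
  exists (mx2 d x 0 d), d'; split=> //; first by exists d, x.
  by rewrite mx3_diag.
- exact: ig_mx3_nilpotent.
- exact: ig_mx3_unipotent.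
Qed.
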